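(* Let $(\pmb{u}_1(t),\pmb{u}_2(t))$ be the exact (in time) solution of the semi-discrete multidomain problem, let $(\pmb{u}_{1,m},\pmb{u}_{2,m})_{0\le m\le M}$ be the fully discrete localized ETD1 solution with time step $\Delta t=T/M$ (both defined in the context), and put $\pmb{e}_{i,m}=\pmb{u}_i(t_m)-\pmb{u}_{i,m}$ for $i=1,2$. For sufficiently smooth data, the localized ETD1 method converges as $\Delta t$ tends to $0$. More precisely, the following error bound holds: $$\|\pmb{e}_{1,\cdot}\|_{\infty,T}+\|\pmb{e}_{2,\cdot}\|_{\infty,T}\le C\,\Delta t,$$ where $C$ is a constant depending on $T$, the size of overlap, the mesh size $h$, $\pmb{u}_1'(N_\alpha,t)$, $\pmb{u}_2'(N_{\beta,\alpha},t)$, the source term $f$ and the boundary data.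
   Context: Setting: consider the one-dimensional diffusion equation $\partial_t u=\nu\,\partial_{xx}u+f(x,t)$ for $0<x<L$, $0<t\le T$, with constant $\nu>0$, boundary conditions $u(0,t)=\psi_1(t)$, $u(L,t)=\psi_2(t)$ and initial condition $u(x,0)=u_0(x)$. Throughout, the data are assumed sufficiently smooth so that there exists a classical solution $u\in C^1(0,T;C^2(\Omega))$, where $\Omega$ here denotes the spatial domain. The equation is discretized in space by cell-centered finite differences on the uniform grid $jh$, $h=L/(N+1)$. For $n\ge1$, $\pmb{A}_{(n)}$ is the $n\times n$ tridiagonal matrix equal to $\frac{\nu}{h^2}$ times the matrix with $-2$ on the diagonal, $1$ on the first sub- and super-diagonals and $0$ elsewhere. $\pmb{I}$ is the identity matrix of the appropriate size. The $j$-th component of a vector $\pmb{v}$ is written $\pmb{v}(j)$; $\pmb{u}_i(j,t)$ is the $j$-th component of $\pmb{u}_i(t)$. Primes denote time derivatives. Overlapping decomposition into $[0,\beta L]$ and $[\alpha L,L]$: $0<\alpha<\beta<1$, $\alpha L=N_\alpha h$, $\beta L=N_\beta h$ with integers $1<N_\alpha<N_\beta<N$; $N_1=N_\beta-1$, $N_2=N-N_\alpha$, $N_{\beta,\alpha}=N_\beta-N_\alpha$; $\pmb{A}_1=\pmb{A}_{(N_1)}$, $\pmb{A}_2=\pmb{A}_{(N_2)}$. For numbers $a,b$, let $\pmb{F}_1(f(t),a,b)\in\mathbb{R}^{N_1}$ be the vector with $j$-th entry $f(jh,t)$, plus $\frac{\nu}{h^2}a$ added to the first entry and $\frac{\nu}{h^2}b$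 added to the last entry; let $\pmb{F}_2(f(t),a,b)\in\mathbb{R}^{N_2}$ be the vector with $j$-th entry $f((N_\alpha+j)h,t)$, plus $\frac{\nu}{h^2}a$ added to the first entry and $\frac{\nu}{h^2}b$ added to the last entry. Semi-discrete multidomain problem: find $\pmb{u}_1:[0,T]\to\mathbb{R}^{N_1}$, $\pmb{u}_2:[0,T]\to\mathbb{R}^{N_2}$ with, for $0<t\le T$, $$\pmb{u}_1'(t)=\pmb{A}_1\pmb{u}_1(t)+\pmb{F}_1(f(t),\psi_1(t),\pmb{u}_2(N_{\beta,\alpha},t)),\qquad \pmb{u}_2'(t)=\pmb{A}_2\pmb{u}_2(t)+\pmb{F}_2(f(t),\pmb{u}_1(N_\alpha,t),\psi_2(t)),$$ $\pmb{u}_1(j,0)=u_0(jh)$ for $1\le j\le N_1$, $\pmb{u}_2(j,0)=u_0((j+N_\alpha)h)$ for $1\le j\le N_2$. Localized ETD1 (first-order exponential time differencing) solution: let $M\ge1$ be an integer, $\Delta t=T/M$, $t_m=m\Delta t$. Set $\pmb{u}_{i,0}=\pmb{u}_i(0)$ and, for $m=0,\dots,M-1$ and $i=1,2$, solve the coupled equations $$\pmb{u}_{i,m+1}=e^{\Delta t\pmb{A}_i}\pmb{u}_{i,m}+\pmb{A}_i^{-1}\left(e^{\Delta t\pmb{A}_i}-\pmb{I}\right)\pmb{F}_{i,m+1},$$ where $\pmb{F}_{1,m}=\pmb{F}_1(f(t_m),\psi_1(t_m),\pmb{u}_{2,m}(N_{\beta,\alpha}))$ and $\pmb{F}_{2,m}=\pmb{F}_2(f(t_m),\pmb{u}_{1,m}(N_\alpha),\psi_2(t_m))$.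 Norm: for a sequence of vectors $(\pmb{v}_m)_{1\le m\le M}$, $\|\pmb{v}_{\cdot}\|_{\infty,T}=\max_{1\le m\le M}\max_j|\pmb{v}_m(j)|$, with $j$ running over all components. *)

(* Defs.v *)
From HB Require Import structures.
From mathcomp Require Export all_boot all_order all_algebra.
From mathcomp Require Export all_classical all_reals all_analysis.

Set Implicit Arguments.
Unset Strict Implicit.
Unset Printing Implicit Defensive.

Export Order.TTheory GRing.Theory Num.Theory.
Export numFieldNormedType.Exports.

Local Open Scope classical_set_scope.
Local Open Scope ring_scope.

(* Derivatives relative to [0, T]: two-sided inside, one-sided at 0 and at T. *)
Definition diff_quot (R : realType) (V : normedModType R) (g : R -> V)
    (t s : R) : V := (s - t)^-1 *: (g s - g t).

Definition has_deriv_on (R : realType) (V : normedModType R) (T : R)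
    (g : R -> V) (t : R) (l : V) : Prop :=
  diff_quot g t s @[s --> within `[0, T] t^'] --> l.

Definition deriv_on (R : realType) (T : R) (g : R -> R) (t : R) : R :=
  lim (diff_quot (V := R^o) g t s @[s --> within `[0, T] t^']).

Definition C1_on (R : realType) (T : R) (g : R -> R) : Prop :=
  exists dg : R -> R,
    {within `[0, T], continuous dg} /\
    forall t, 0 <= t <= T -> has_deriv_on (V := R^o) T g t (dg t).

(* The class C^1(0,T; C^2(Omega)) with Omega = ]0, L[: here d k l stands for
   the k-th space derivative of the l-th time derivative of u. *)
Definition C1C2 (R : realType) (L T : R) (u : R -> R -> R) : Prop :=
  exists d : nat -> nat -> R -> R -> R,
    [/\ d 0%N 0%N = u,
        forall k l, (k <= 2)%N -> (l <= 1)%N ->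
          {within [set p : R * R | 0 < p.1 < L /\ 0 < p.2 <= T],
             continuous (fun p : R * R => d k l p.1 p.2)},
        forall k l x t, (k < 2)%N -> (l <= 1)%N -> 0 < x < L -> 0 < t <= T ->
          is_derive x (1 : R) (fun y => d k l y t) (d k.+1 l x t) &
        forall k x t, (k <= 2)%N -> 0 < x < L -> 0 < t <= T ->
          has_deriv_on (V := R^o) T (d k 0%N x) t (d k 1%N x t)].

Definition classical_solution (R : realType) (nu L T : R) (f : R -> R -> R)
    (psi1 psi2 u0 : R -> R) (u : R -> R -> R) : Prop :=
  [/\ C1C2 L T u,
      {within [set p : R * R | 0 <= p.1 <= L /\ 0 <= p.2 <= T],
         continuous (fun p : R * R => u p.1 p.2)},
      forall x t, 0 < x < L -> 0 < t <= T ->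
        deriv_on T (u x) t =
          nu * derive1 (derive1 (fun y => u y t)) x + f x t,
      forall t, 0 <= t <= T -> u 0 t = psi1 t /\ u L t = psi2 t &
      forall x, 0 <= x <= L -> u x 0 = u0 x].

(* Besides the existence of a classical solution, a first-order error bound
   needs data that are C^1 in time up to t = 0 and t = T. *)
Definition smooth_data (R : realType) (nu L T : R) (f : R -> R -> R)
    (psi1 psi2 u0 : R -> R) : Prop :=
  [/\ exists u, classical_solution nu L T f psi1 psi2 u0 u,
      forall x, 0 < x < L -> C1_on T (f x),
      C1_on T psi1 &
      C1_on T psi2].

Definition lap (R : realType) (nu h : R) (n : nat) : 'M[R]_n :=
  \matrix_(i < n, j < n)
    (nu / h ^+ 2 *
       (if i == j then - 2
        else if (i.+1 == j :> nat) || (j.+1 == i :> nat) then 1 else 0)).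

Definition expmx (R : realType) (n : nat) (A : 'M[R]_n) : 'M[R]_n :=
  limn (series (fun k => (k`!%:R)^-1 *: A ^+ k)).

(* The component v(j), numbered from 1, of a vector (0 if j is out of range). *)
Definition vcomp (R : realType) (n : nat) (v : 'cV[R]_n) (j : nat) : R :=
  \sum_(i < n | i.+1 == j) v i 0.

(* F_1 is the case k = 0, n = N_1; F_2 is the case k = N_alpha, n = N_2. *)
Definition forcing (R : realType) (nu h : R) (k n : nat) (f : R -> R -> R)
    (t a b : R) : 'cV[R]_n :=
  \col_(j < n) (f ((k + j.+1)%:R * h) t
    + (if j.+1 == 1%N then nu / h ^+ 2 * a else 0)
    + (if j.+1 == n then nu / h ^+ 2 * b else 0)).

Definition semidiscrete_solution (R : realType) (nu h T : R) (Na Nb N : nat)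
    (f : R -> R -> R) (psi1 psi2 u0 : R -> R)
    (u1 : R -> 'cV[R]_(Nb - 1)) (u2 : R -> 'cV[R]_(N - Na)) : Prop :=
  [/\ {within `[0, T], continuous u1},
      {within `[0, T], continuous u2},
      forall t, 0 < t <= T ->
        has_deriv_on T u1 t
          (lap nu h (Nb - 1) *m u1 t
           + forcing nu h 0 (Nb - 1) f t (psi1 t) (vcomp (u2 t) (Nb - Na))) /\
        has_deriv_on T u2 t
          (lap nu h (N - Na) *m u2 t
           + forcing nu h Na (N - Na) f t (vcomp (u1 t) Na) (psi2 t)),
      forall j, (1 <= j <= Nb - 1)%N -> vcomp (u1 0) j = u0 (j%:R * h) &
      forall j, (1 <= j <= N - Na)%N -> vcomp (u2 0) j = u0 ((j + Na)%:R * h)].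

Definition etd1_step (R : realType) (n : nat) (A : 'M[R]_n) (dt : R)
    (v F : 'cV[R]_n) : 'cV[R]_n :=
  expmx (dt *: A) *m v + invmx A *m (expmx (dt *: A) - 1%:M) *m F.

Definition etd1_solution (R : realType) (nu h dt : R) (M Na Nb N : nat)
    (f : R -> R -> R) (psi1 psi2 : R -> R)
    (u10 : 'cV[R]_(Nb - 1)) (u20 : 'cV[R]_(N - Na))
    (v1 : nat -> 'cV[R]_(Nb - 1)) (v2 : nat -> 'cV[R]_(N - Na)) : Prop :=
  [/\ v1 0%N = u10,
      v2 0%N = u20 &
      forall m, (m < M)%N ->
        let t := m.+1%:R * dt in
        v1 m.+1 = etd1_step (lap nu h (Nb - 1)) dt (v1 m)
          (forcing nu h 0 (Nb - 1) f t (psi1 t) (vcomp (v2 m.+1) (Nb - Na))) /\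
        v2 m.+1 = etd1_step (lap nu h (N - Na)) dt (v2 m)
          (forcing nu h Na (N - Na) f t (vcomp (v1 m.+1) Na) (psi2 t))].

Definition norm_infT (R : realType) (n M : nat) (v : nat -> 'cV[R]_n) : R :=
  \big[Num.max/0]_(1 <= m < M.+1) \big[Num.max/0]_(j < n) `|v m j 0|.

Definition etd1_error (R : realType) (T : R) (M n1 n2 : nat)
    (u1 : R -> 'cV[R]_n1) (u2 : R -> 'cV[R]_n2)
    (v1 : nat -> 'cV[R]_n1) (v2 : nat -> 'cV[R]_n2) : R :=
  norm_infT M (fun m => u1 (m%:R * (T / M%:R)) - v1 m)
  + norm_infT M (fun m => u2 (m%:R * (T / M%:R)) - v2 m).

(* Main.v *)
Require Import Defs.
From mathcomp Require Import ring lra zify.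
Set Implicit Arguments.
Unset Strict Implicit.
Unset Printing Implicit Defensive.
Local Open Scope classical_set_scope.
Local Open Scope ring_scope.

(** Over one time step, the ETD1 update is the final value of the solution of
the linear system [phi' = A phi + F] with the forcing [F] frozen at the new
time ([is_derive_etd1_step]).  The error on a subdomain therefore solves, over
the step, a linear system with the same matrix, whose source is the true
forcing minus the frozen one.  The discrete Laplacian has nonnegative
off-diagonal entries, so such systems preserve positivity
([linear_positivity]), and an error that starts strictly below a vector [y]
stays strictly below it as long as the source is at most [- A y]
([etd1_step_error]).

The vector [y] comes from one parabola on the whole interval,
[q x = rho / (2 nu) * x (L - x)] with [rho = K (1 + 2 nu / h^2) dt].  Second
differences of a quadratic are exact, so minus the discrete Laplacian of [q] on
a subdomain is the constant [rho] plus the contributions of [q] at the two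
boundary nodes ([lap_parabola]).  The constant [rho] pays for freezing the
source term and the two boundary values, each of which moves by at most
[K dt] during a step.  Since the same [q] serves on both subdomains, the bound
on one of them is exactly the bound needed for the interface value that it
hands to the other.

The coupling is implicit: the interface errors are those at the new time, so
the new bounds are needed to prove themselves.  Strictness resolves this.  If
all new errors are at most [theta q] with [theta > 1], then they are smaller
than [theta q] ([subdomain_step]), so the largest ratio of an error to [q]
cannot exceed 1 ([self_improving_bound]).  Hence the errors stay below [q] at
all steps, without growth in time ([coupled_step]), and
[q <= rho L^2 / (2 nu)] is of order [dt].

Finally [K] has to be a function of the data listed in the statement.  It is
picked by choice among all common moduli of these data ([data_modulus]); there
is one because the data are C^1 in time and the right-hand side of the
semi-discrete system is bounded on [0, T] ([data_modulus_exists]). *)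

(** * The matrix exponential and the ETD1 flow *)

(** Entries of the exponential are scalar power series, so that termwise
differentiation of real power series applies to them. *)
Definition expmx_coef (R : realType) n (A : 'M[R]_n) (i j : 'I_n) (k : nat) : R :=
  (A ^+ k) i j / k`!%:R.

(** The crude bound by powers of the sum of all entries is enough to compare
the entries of the exponential with a scalar exponential series. *)
Lemma pow_entry_le (R : realType) n (A : 'M[R]_n) (i j : 'I_n) k :
  `|(A ^+ k) i j| <= (\sum_i \sum_j `|A i j|) ^+ k.
Proof.
set B := \sum_i _.
have B0 : 0 <= B by do 2 (apply: sumr_ge0 => ? _).
elim: k i j => [|k IH] i j.
  rewrite !expr0 mxE; case: eqP => _; by rewrite ?normr1 ?normr0.
rewrite !exprS mxE (le_trans (ler_norm_sum _ _ _))//.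
apply: (@le_trans _ _ (\sum_l `|A i l| * B ^+ k)).
  by apply: ler_sum => l _; rewrite normrM ler_wpM2l.
rewrite -mulr_suml ler_wpM2r ?exprn_ge0// /B [leRHS](bigD1 i)//= lerDl.
by do 2 (apply: sumr_ge0 => ? _).
Qed.

Lemma expmx_coef_diffs (R : realType) n (A : 'M[R]_n) (i j : 'I_n) :
  pseries_diffs (expmx_coef A i j) =
  fun k => \sum_l A i l * expmx_coef A l j k.
Proof.
apply/funext => k; rewrite /pseries_diffs /expmx_coef exprS mxE mulr_suml mulr_sumr.
apply: eq_bigr => l _; rewrite factS natrM invfM.
have k0 : k.+1%:R != 0 :> R by rewrite pnatr_eq0.
have k1 : k`!%:R != 0 :> R by rewrite pnatr_eq0 -lt0n fact_gt0.
by field; rewrite k1 addrC natr1 k0.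
Qed.

Lemma expmx_coef_cvg (R : realType) n (A : 'M[R]_n) (i j : 'I_n) (s : R) :
  cvgn (pseries (expmx_coef A i j) s).
Proof.
apply: normed_cvg.
set B := \sum_i \sum_j `|A i j|.
have B0 : 0 <= B by do 2 (apply: sumr_ge0 => ? _).
apply: (@series_le_cvg _ _ (exp_coeff (B * `|s|))).
- by move=> k; exact: normr_ge0.
- by move=> k; rewrite exp_coeff_ge0// mulr_ge0.
- move=> k; rewrite /exp_coeff /= /expmx_coef !normrM normfV normrX normr_nat.
  by rewrite mulrAC ler_wpM2r ?invr_ge0// exprMn ler_wpM2r ?exprn_ge0 ?pow_entry_le.
- exact: is_cvg_series_exp_coeff.
Qed.

Lemma pseries_sum (R : realType) (I : finType) (a : I -> R) (c : I -> nat -> R) s :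
  pseries (fun k => \sum_l a l * c l k) s = fun N => \sum_l a l * pseries (c l) s N.
Proof.
apply/funext => N; rewrite /pseries /series /=.
under [RHS]eq_bigr do rewrite mulr_sumr.
rewrite exchange_big /=; apply: eq_bigr => k _; rewrite mulr_suml.
by apply: eq_bigr => l _; rewrite mulrA.
Qed.

Lemma cvg_sum_pseries (R : realType) (I : finType) (a : I -> R) (c : I -> nat -> R) s :
  (forall l, cvgn (pseries (c l) s)) ->
  pseries (fun k => \sum_l a l * c l k) s @ \oo --> \sum_l a l * limn (pseries (c l) s).
Proof.
move=> cc; rewrite pseries_sum; apply: cvg_big => //=.
  by move=> [x y]/=; apply: cvgD; [exact: cvg_fst|exact: cvg_snd].
by move=> l _; apply: cvgMr; exact: cc.
Qed.

Lemma expmx_scale (R : realType) n (A : 'M[R]_n) (s : R) k :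
  (s *: A) ^+ k = s ^+ k *: A ^+ k.
Proof.
elim: k => [|k IH]; first by rewrite !expr0 scale1r.
rewrite !exprS IH -[LHS]/((s *: A) *m (s ^+ k *: A ^+ k)) -[A * _]/(A *m A ^+ k).
by rewrite -scalemxAl -scalemxAr scalerA.
Qed.

Lemma expmx_entry (R : realType) n (A : 'M[R]_n) (i j : 'I_n) (s : R) :
  expmx (s *: A) i j = limn (pseries (expmx_coef A i j) s).
Proof.
set E : 'M[R]_n := \matrix_(i, j) limn (pseries (expmx_coef A i j) s).
suff -> : expmx (s *: A) = E by rewrite mxE.
apply/cvg_lim.
  by have H := @norm_hausdorff R ('M[R]_n : normedModType R); exact: H.
apply/cvg_mx_entourageP => U entU.
change (\forall N \near \oo, forall k l,
  (E k l, series (fun k => (k`!%:R)^-1 *: (s *: A) ^+ k) N k l) \in U).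
near=> N => k l.
rewrite inE/= mxE /=.
have -> : series (fun k => (k`!%:R)^-1 *: (s *: A) ^+ k) N k l = pseries (expmx_coef A k l) s N.
  rewrite /pseries /series /= summxE; apply: eq_bigr => m _.
  by rewrite expmx_scale !mxE /expmx_coef; ring.
move: k l; near: N.
apply: filter_forall => k; apply: filter_forall => l.
have /cvg_entourageP := @expmx_coef_cvg R n A k l s.
exact.
Unshelve. all: by end_near. Qed.

Lemma is_derive_expmx (R : realType) n (A : 'M[R]_n) (i j : 'I_n) (s : R) :
  is_derive s (1 : R) (fun s => expmx (s *: A) i j)
    ((A *m expmx (s *: A)) i j).
Proof.
have -> : (fun s => expmx (s *: A) i j) = (fun s => limn (pseries (expmx_coef A i j) s)).
  by apply/funext => t; exact: expmx_entry.
have H s' (a : 'I_n -> R) : cvgn (pseries (fun k => \sum_l a l * expmx_coef A l j k) s').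
  by apply/cvg_ex; eexists; apply: cvg_sum_pseries => l; exact: expmx_coef_cvg.
have -> : (A *m expmx (s *: A)) i j = limn (pseries (pseries_diffs (expmx_coef A i j)) s).
  rewrite mxE expmx_coef_diffs; apply/esym/cvg_lim => //.
  under eq_bigr do rewrite expmx_entry.
  by apply: cvg_sum_pseries => l; exact: expmx_coef_cvg.
apply: (@pseries_snd_diffs _ _ (`|s| + 1)).
- exact: expmx_coef_cvg.
- by rewrite expmx_coef_diffs; exact: H.
- rewrite expmx_coef_diffs.
  (* Differentiating twice gives the entries of A^2 e^(sA). *)
  have -> : pseries_diffs (fun k => \sum_l A i l * expmx_coef A l j k) =
     fun k => \sum_l (A *m A) i l * expmx_coef A l j k.
    apply/funext => k; rewrite /pseries_diffs mulr_sumr.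
    transitivity (\sum_l A i l * pseries_diffs (expmx_coef A l j) k).
      by apply: eq_bigr => l _; rewrite /pseries_diffs; ring.
    under eq_bigr do rewrite expmx_coef_diffs mulr_sumr.
    rewrite exchange_big /=; apply: eq_bigr => l _; rewrite mxE mulr_suml.
    by apply: eq_bigr => m _; rewrite mulrA.
  exact: H.
- by rewrite [ltRHS]ger0_norm ?addr_ge0// ltrDl.
Qed.

Lemma expmx0 (R : realType) n : expmx (0 : 'M[R]_n) = 1%:M.
Proof.
apply/matrixP => i j; rewrite -(scale0r (0 : 'M[R]_n)) expmx_entry.
apply/cvg_lim => //; rewrite -(cvg_shiftS _)/=.
apply: cvg_near_cst; near=> N.
rewrite /pseries /series /= big_nat_recl//= big1 ?addr0.
  by rewrite /expmx_coef !expr0 mulr1 divr1.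
by move=> k _; rewrite exprS mul0r mulr0.
Unshelve. all: by end_near. Qed.

Lemma etd1_step0 (R : realType) n (A : 'M[R]_n) (v F : 'cV[R]_n) :
  etd1_step A 0 v F = v.
Proof. by rewrite /etd1_step scale0r expmx0 subrr mulmx0 mul0mx mul1mx addr0. Qed.

(** The ETD1 formula is the variation of constants formula for a frozen
forcing, because the inverse of [A] times [e^(sA) - 1] is the integral of
[e^(rA)] over [0, s]. *)
Lemma is_derive_etd1_step (R : realType) n (A : 'M[R]_n) (v F : 'cV[R]_n) (i : 'I_n) (s : R) :
  A \in unitmx ->
  is_derive s (1 : R) (fun s => etd1_step A s v F i 0)
    ((A *m etd1_step A s v F + F) i 0).
Proof.
move=> uA.
pose B := invmx A.
have D j l := @is_derive_expmx R n A j l s.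
have -> : (fun s => etd1_step A s v F i 0) =
   \sum_l (fun s => expmx (s *: A) i l * v l 0)
   + \sum_j \sum_l (fun s => B i j * ((expmx (s *: A) j l - (1%:M : 'M[R]_n) j l) * F l 0)).
  apply/funext => t; rewrite /etd1_step -mulmxA !mxE fctE !fct_sumE; congr (_ + _).
  apply: eq_bigr => j _; rewrite fct_sumE mxE mulr_sumr; apply: eq_bigr => l _.
  by rewrite !mxE.
apply: is_derive_eq.
set E := expmx (s *: A).
transitivity ((A *m E *m v + B *m (A *m E *m F)) i 0).
  rewrite !mxE; congr (_ + _).
    by apply: eq_bigr => l _; rewrite scaler0 add0r mulrC.
  apply: eq_bigr => j _; rewrite mxE mulr_sumr; apply: eq_bigr => l _.
  by rewrite scaler0 add0r subr0 [F l 0 *: _]mulrC.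
rewrite /etd1_step -/E -/B mulmxDr !mulmxA !mulmxBr mulmx1 mulmxBl.
rewrite (mulVmx uA) (mulmxV uA) !mul1mx.
by rewrite -addrA subrK.
Qed.

(** * Positivity of linear systems with nonnegative off-diagonal entries *)

Lemma nondecreasing_of_derive (R : realType) (g dg : R -> R) (a b : R) :
  a <= b ->
  {within `[a, b], continuous g} ->
  (forall t, a < t < b -> is_derive t (1 : R) g (dg t)) ->
  (forall t, a < t < b -> 0 <= dg t) ->
  g a <= g b.
Proof.
rewrite le_eqVlt => /predU1P[->//|ab] cg Dg dg0.
have D t : t \in `]a, b[ -> is_derive t (1 : R) g (dg t) by rewrite in_itv/= => /Dg.
have [c cab E] := MVT ab D cg.
rewrite -subr_ge0 E mulr_ge0 ?subr_ge0 ?(ltW ab)//.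
by apply: dg0; move: cab; rewrite in_itv.
Qed.

Lemma lipschitz_of_derive (R : realType) (g dg : R -> R) (a b K : R) :
  {within `[a, b], continuous g} ->
  (forall t, a < t < b -> is_derive t (1 : R) g (dg t)) ->
  (forall t, a < t < b -> `|dg t| <= K) ->
  forall s t, a <= s <= b -> a <= t <= b -> `|g s - g t| <= K * `|s - t|.
Proof.
move=> cg Dg dgK.
have H s t : a <= s -> s < t -> t <= b -> `|g s - g t| <= K * `|s - t|.
  move=> as_ st tb.
  have D x : x \in `]s, t[ -> is_derive x (1 : R) g (dg x).
    rewrite in_itv/= => /andP[sx xt]; apply: Dg.
    by rewrite (le_lt_trans as_ sx) (lt_le_trans xt tb).
  have cg' : {within `[s, t], continuous g}.
    apply: continuous_subspaceW cg => x /=; rewrite !in_itv/= => /andP[sx xt].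
    by rewrite (le_trans as_ sx) (le_trans xt tb).
  have [c cab E] := MVT st D cg'.
  rewrite distrC E normrM [`|s - t|]distrC ler_wpM2r// dgK//.
  move: cab; rewrite in_itv/= => /andP[sx xt].
  by rewrite (le_lt_trans as_ sx) (lt_le_trans xt tb).
move=> s t /andP[as_ sb] /andP[at_ tb].
case: (ltgtP s t) => [st|ts|->].
- exact: H.
- by rewrite distrC [`|s - t|]distrC; exact: H.
- by rewrite !subrr normr0 mulr0.
Qed.

(** As long as all components are positive, the off-diagonal terms push each
component up, so that [e^(- A_ii t) w_i] is nondecreasing and cannot reach zero:
there is no first exit time from the positive cone. *)
Lemma linear_positivity (R : realType) n (A : 'M[R]_n) (w dw : 'I_n -> R -> R)
    (a b : R) :
  a <= b ->
  (forall i j, i != j -> 0 <= A i j) ->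
  (forall i, {within `[a, b], continuous (w i)}) ->
  (forall i t, a < t < b -> is_derive t (1 : R) (w i) (dw i t)) ->
  (forall i t, a < t < b -> \sum_j A i j * w j t <= dw i t) ->
  (forall i, 0 < w i a) ->
  forall i, 0 < w i b.
Proof.
move=> ab Aoff cw Dw dwA wa.
(* Positivity on [a, t[ makes every weighted component nondecreasing there. *)
have step t : a <= t <= b -> (forall s j, a <= s < t -> 0 < w j s) ->
    forall i, 0 < w i t.
  move=> /andP[at_ tb] pos i.
  pose g s := expR (- A i i * s) * w i s.
  pose dg s := expR (- A i i * s) * (dw i s - A i i * w i s).
  suff : g a <= g t.
    rewrite /g => /(lt_le_trans _) H; have := H _ (mulr_gt0 (expR_gt0 _) (wa i)).
    by rewrite pmulr_rgt0 ?expR_gt0.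
  apply: (@nondecreasing_of_derive _ g dg) => //.
  - have sub : {within `[a, t], continuous (w i)}.
      apply: continuous_subspaceW (cw i) => x /=; rewrite !in_itv/= => /andP[-> xt].
      exact: le_trans xt tb.
    have ce : {within `[a, t], continuous (fun s => expR (- A i i * s))}.
      apply: continuous_subspaceT => x.
      apply: continuous_comp; last exact: continuous_expR.
      by apply: cvgMr; exact: cvg_id.
    by move=> x; exact: cvgM (ce x) (sub x).
  - move=> s /andP[as_ st].
    have := Dw i s; rewrite as_ (lt_le_trans st tb) => /(_ isT) D.
    by apply: is_derive_eq; rewrite /dg /GRing.scale/=; ring.
  - move=> s /andP[as_ st]; rewrite mulr_ge0 ?expR_ge0// subr_ge0.
    apply: le_trans (dwA i s _); last by rewrite as_ (lt_le_trans st tb).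
    rewrite (bigD1 i)//= lerDl sumr_ge0// => j ji.
    rewrite mulr_ge0 ?Aoff 1?eq_sym// ltW// pos// st ltW//.
have [//|] := pselect (forall i, 0 < w i b).
move=> /existsNP[i0 Hi0] i; exfalso; move: i => _.
(* The infimum of S would be the first exit time. *)
pose S := [set t | a <= t <= b /\ exists i, w i t <= 0].
have Sb : S b.
  split; first by rewrite ab lexx.
  by exists i0; move/negP: Hi0; rewrite -leNgt.
have hS : has_inf S by split; [exists b | exists a => x [/andP[]]].
have lbS x : S x -> inf S <= x by move=> Sx; exact: ge_inf hS.2 _ Sx.
set t0 := inf S.
have at0 : a <= t0 by apply: lb_le_inf hS.1 _ => x [/andP[]].
have t0b : t0 <= b by exact: lbS.
have t0ab : t0 \in `[a, b] by rewrite in_itv/= at0.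
have pos : forall i, 0 < w i t0.
  apply: step; rewrite ?at0// => s j /andP[as_ st].
  rewrite ltNge; apply/negP => wle.
  have /lbS : S s by split; [rewrite as_ (le_trans (ltW st) t0b) | exists j].
  by rewrite leNgt st.
have nearpos : \forall s \near within `[a, b] (nbhs t0), forall i, 0 < w i s.
  apply: filter_forall => i.
  have /subspace_continuousP/(_ t0 t0ab) := cw i.
  by move=> /(cvgr_gt (w i t0))/(_ _ (pos i)).
move: nearpos; rewrite near_withinE => /nbhs_ballP[d /= d0 dpos].
have [s Ss sd] := inf_adherent d0 hS.
have [sab [j wj]] := Ss.
have /dpos : ball t0 d s.
  by rewrite /ball/= distrC ger0_norm ?subr_ge0 ?lbS// ltrBlDl.
by rewrite /= in_itv/= => /(_ sab j); rewrite ltNge wj.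
Qed.


(** Both [y - (u - phi)] and [y + (u - phi)], with [phi] the ETD1 flow, satisfy
the hypotheses of [linear_positivity], since [y] is a supersolution for the
residual forcing. *)
Lemma etd1_step_error (R : realType) n (A : 'M[R]_n) (u F : R -> 'cV[R]_n)
    (v Phi y : 'cV[R]_n) (a b : R) :
  a <= b ->
  A \in unitmx ->
  (forall i j, i != j -> 0 <= A i j) ->
  (forall i, {within `[a, b], continuous (fun t => u t i 0)}) ->
  (forall i t, a < t < b ->
     is_derive t (1 : R) (fun t => u t i 0) ((A *m u t + F t) i 0)) ->
  (forall i t, a < t < b -> `|F t i 0 - Phi i 0| <= - (A *m y) i 0) ->
  (forall i, `|u a i 0 - v i 0| < y i 0) ->
  forall i, `|u b i 0 - etd1_step A (b - a) v Phi i 0| < y i 0.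
Proof.
move=> ab uA Aoff cu Du res init.
pose phi t := etd1_step A (t - a) v Phi.
have Dphi i t : is_derive t (1 : R) (fun t => phi t i 0) ((A *m phi t + Phi) i 0).
  have D := is_derive_etd1_step v Phi i (t - a) uA.
  have Ds : is_derive t (1 : R) (fun t : R => t - a) 1.
    by apply: is_derive_eq; rewrite subr0.
  have := @is_derive1_comp _ (fun s => etd1_step A s v Phi i 0) (fun t : R => t - a) t _ _ D Ds.
  by rewrite mulr1.
have cphi i : {within `[a, b], continuous (fun t => phi t i 0)}.
  apply: continuous_subspaceT => t.
  by apply: differentiable_continuous; apply/derivable1_diffP; case: (Dphi i t).
have phia : phi a = v by rewrite /phi subrr etd1_step0.
(* The two signs sg = 1 and sg = -1 give the two one-sided bounds. *)
have main (sg : R) : `|sg| = 1 ->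
    forall i, 0 < y i 0 - sg * (u b i 0 - phi b i 0).
  move=> sg1.
  pose w i t := y i 0 - sg * (u t i 0 - phi t i 0).
  pose dw i t := - (sg * ((A *m u t + F t) i 0 - (A *m phi t + Phi) i 0)).
  apply: (@linear_positivity _ _ A w dw a b) => //.
  - move=> i t.
    by apply: cvgB; [exact: cvg_cst|apply: cvgMr; apply: cvgB; [exact: cu|exact: cphi]].
  - move=> i t tab; have := Du i t tab => D; have := Dphi i t => D'.
    by apply: is_derive_eq; rewrite /dw /GRing.scale/=; ring.
  - move=> i t tab.
    have -> : \sum_j A i j * w j t = (A *m y) i 0 - sg * ((A *m u t) i 0 - (A *m phi t) i 0).
      rewrite !mxE -sumrB mulr_sumr -sumrB; apply: eq_bigr => j _.
      by rewrite /w; ring.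
    rewrite /dw [(A *m u t + F t) i 0]mxE [(A *m phi t + Phi) i 0]mxE.
    have := res i t tab; rewrite -[`|_|]mul1r -sg1 -normrM.
    by rewrite ler_norml => /andP[_]; lra.
  - move=> i; rewrite /w phia subr_gt0.
    apply: le_lt_trans (init i); apply: le_trans (ler_norm _) _.
    by rewrite normrM sg1 mul1r.
move=> i; rewrite ltr_norml -/(phi b).
have := main 1 (normr1 _) i; have := main (-1) _ i; rewrite normrN normr1 => /(_ erefl).
by lra.
Qed.

(** This closes the implicit coupling: an a priori bound with a factor
[theta > 1] that always improves strictly rules out that the largest ratio
[|e i| / z i] exceeds 1. *)
Lemma self_improving_bound (R : realType) (I : finType) (e z : I -> R) :
  (forall i, 0 < z i) ->
  (forall theta, 1 < theta -> (forall i, `|e i| <= theta * z i) ->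
     forall i, `|e i| < theta * z i) ->
  forall i, `|e i| <= z i.
Proof.
move=> z0 impr i0.
case: (@Order.TotalTheory.arg_maxP _ _ _ i0 xpredT (fun i => `|e i| / z i)) => // i _ imax.
have [le1|gt1] := leP (`|e i| / z i) 1.
  rewrite -[leRHS]mul1r -ler_pdivrMr//.
  exact: le_trans (imax i0 isT) le1.
have := impr _ gt1 _ i; rewrite divfK ?gt_eqF// ltxx => H.
suff: false by [].
apply: H => j; rewrite -ler_pdivrMr//; exact: imax.
Qed.

(** * The discrete Laplacian and its parabolic barrier *)

(** By [self_improving_bound], a vector [v] in the kernel is dominated by every
positive multiple of [z]: at an index where [c z - v >= 0] vanishes, its image
under [A] would be nonnegative, while it equals [c A z < 0]. *)
Lemma metzler_unitmx (R : realType) n (A : 'M[R]_n) (z : 'cV[R]_n) :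
  (forall i j, i != j -> 0 <= A i j) ->
  (forall i, 0 < z i 0) ->
  (forall i, (A *m z) i 0 < 0) ->
  A \in unitmx.
Proof.
move=> Aoff z0 Az0.
rewrite -unitmx_tr -row_free_unit -kermx_eq0; apply/negPn/negP => /rowV0Pn[v0 /sub_kermxP kv vn0].
pose v := v0^T.
have Av : A *m v = 0 by apply: trmx_inj; rewrite trmx_mul trmxK kv trmx0.
(* As above, sg = 1 and sg = -1 bound v from both sides. *)
have strict (sg theta : R) : `|sg| = 1 -> 0 < theta ->
    (forall i, `|v i 0| <= theta * z i 0) -> forall i, 0 < theta * z i 0 - sg * v i 0.
  move=> sg1 th0 bd i.
  pose w := theta *: z - sg *: v.
  have wE j : w j 0 = theta * z j 0 - sg * v j 0 by rewrite !mxE.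
  have w0 j : 0 <= w j 0.
    rewrite wE subr_ge0; apply: le_trans (bd j); apply: le_trans (ler_norm _) _.
    by rewrite normrM sg1 mul1r.
  rewrite -wE lt_neqAle w0 andbT; apply/eqP => wi.
  have : (A *m w) i 0 < 0.
    rewrite mulmxBr -!scalemxAr Av scaler0 subr0 mxE.
    by rewrite pmulr_rlt0.
  apply/negP; rewrite -leNgt mxE sumr_ge0// => j _.
  have [->|ij] := eqVneq j i; first by rewrite -wi mulr0.
  by rewrite mulr_ge0 ?Aoff 1?eq_sym.
have small (c : R) : 0 < c -> forall i, `|v i 0| <= c * z i 0.
  move=> c0; apply: self_improving_bound => [i|theta th1 bd i]; first by rewrite mulr_gt0.
  have th0 : 0 < theta * c by rewrite mulr_gt0// (lt_trans ltr01).
  have bd' j : `|v j 0| <= theta * c * z j 0 by rewrite -mulrA.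
  have := strict 1 _ (normr1 _) th0 bd' i; have := strict (-1) _ _ th0 bd' i.
  rewrite normrN normr1 => /(_ erefl); rewrite ltr_norml mulrA.
  by move: (v i 0) (theta * c * z i 0) => V W; lra.
case/negP: vn0; apply/eqP/rowP => i; rewrite [RHS]mxE.
have -> : v0 0 i = v i 0 by rewrite mxE.
apply/eqP; rewrite -normr_le0 leNgt; apply/negP => vi.
have := small (`|v i 0| / (2 * z i 0)) _ i.
rewrite divr_gt0 ?mulr_gt0// => /(_ isT).
have := z0 i => zi.
rewrite (_ : _ * z i 0 = `|v i 0| / 2); first lra.
by field; rewrite gt_eqF.
Qed.

Lemma lap_offdiag (R : realType) (nu h : R) n (i j : 'I_n) :
  0 < nu -> 0 < h -> i != j -> 0 <= lap nu h n i j.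
Proof.
move=> nu0 h0 /negPf ij; rewrite mxE ij mulr_ge0 ?divr_ge0 ?exprn_ge0 ?(ltW nu0) ?(ltW h0)//.
by case: ifP.
Qed.

Lemma sum_ord_eq (R : realType) n (m : nat) (c : R) :
  \sum_(j < n) (if (j : nat) == m then c else 0) = if (m < n)%N then c else 0.
Proof.
rewrite -big_mkcond /=; case: ifP => mn.
  by rewrite (big_pred1 (Ordinal mn)).
rewrite big_pred0// => j; apply/eqP => jm.
by rewrite -jm ltn_ord in mn.
Qed.

(** Away from the ends the matrix takes second differences; at the ends it drops
the values [g 0] and [g n.+1], whence the two corrections. *)
Lemma lap_mul_col (R : realType) (nu h : R) n (g : nat -> R) (i : 'I_n) :
  (lap nu h n *m \col_j g j.+1) i 0 =
  nu / h ^+ 2 * (g i - 2 * g i.+1 + g i.+2)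
  - (if i.+1 == 1%N then nu / h ^+ 2 * g 0%N else 0)
  - (if i.+1 == n then nu / h ^+ 2 * g n.+1 else 0).
Proof.
set ka := nu / _.
have -> : (lap nu h n *m \col_j g j.+1) i 0 =
  ka * (\sum_(j < n) (if (j : nat) == i then - 2 * g i.+1 else 0)
  + \sum_(j < n) (if (j : nat) == i.+1 then g i.+2 else 0)
  + (if (0 < i)%N then \sum_(j < n) (if (j : nat) == i.-1 then g i else 0) else 0)).
  have -> : (if (0 < i)%N then \sum_(j < n) (if (j : nat) == i.-1 then g i else 0) else 0)
     = \sum_(j < n) (if j.+1 == i then g i else 0).
    case: ifP => i0; first by apply: eq_bigr => j _; rewrite -eqSS prednK.
    by rewrite big1// => j _; case: eqP => // ji; rewrite -ji in i0.
  rewrite mxE -!big_split mulr_sumr /=; apply: eq_bigr => j _; rewrite !mxE -/ka.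
  have -> : (i == j) = ((j : nat) == i) by rewrite eq_sym.
  have -> : (i.+1 == j :> nat) = ((j : nat) == i.+1) by rewrite eq_sym.
  case: (ltngtP j i) => ji.
  - have -> : ((j : nat) == i.+1) = false by apply/eqP; lia.
    by case: eqP => /= [->|_]; ring.
  - have -> : (j.+1 == i) = false by apply/eqP; lia.
    by case: eqP => /= [->|_]; ring.
  - rewrite ji (_ : (_ == _.+1) = false); last by apply/eqP; lia.
    by rewrite (_ : (_.+1 == _) = false); [ring|apply/eqP; lia].
rewrite !sum_ord_eq ltn_ord eqSS.
have -> : (i.-1 < n)%N by have := ltn_ord i; lia.
have -> : (i.+1 == n) = ~~ (i.+1 < n)%N by have := ltn_ord i; case: ltngtP => //; lia.
case: (ltnP i.+1 n) => h1 /=.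
  by case: (posnP i) => [->|]/=; [ring|move=> i0; ring].
have -> : i.+2 = n.+1 by have := ltn_ord i; lia.
by case: (posnP i) => [->|]/=; [ring|move=> i0; ring].
Qed.

(** The solution of [nu q'' + rho = 0] that vanishes at 0 and [L]. *)
Definition parabola (R : realType) (nu L rho x : R) : R := rho / (2 * nu) * (x * (L - x)).

(** The three-point second difference of a quadratic is exact; the boundary
values of [q] enter just as Dirichlet data do in [forcing].  The time [t] is
arbitrary, as the source is constant. *)
Lemma lap_parabola (R : realType) (nu h L rho t : R) (k n : nat) :
  0 < nu -> 0 < h ->
  let q m := parabola nu L rho (m%:R * h) in
  - (lap nu h n *m \col_j q (k + j.+1)%N) =
  forcing nu h k n (fun _ _ => rho) t (q k) (q (k + n.+1)%N).
Proof.
move=> nu0 h0 q; apply/colP => i; rewrite mxE.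
rewrite (lap_mul_col nu h (fun j => q (k + j)%N)) [RHS]mxE addn0.
set a := if _ then _ else _; set b := if _ then _ else _.
suff -> : nu / h ^+ 2 * (q (k + i)%N - 2 * q (k + i.+1)%N + q (k + i.+2)%N) = - rho by ring.
rewrite /q /parabola !natrD -!natr1.
by field; rewrite !gt_eqF.
Qed.

Lemma parabola_gt0 (R : realType) (nu L rho x : R) :
  0 < nu -> 0 < rho -> 0 < x < L -> 0 < parabola nu L rho x.
Proof.
move=> nu0 r0 /andP[x0 xL].
by rewrite /parabola mulr_gt0 ?divr_gt0 ?mulr_gt0 ?subr_gt0.
Qed.

Lemma parabola_left (R : realType) (nu L rho : R) : parabola nu L rho 0 = 0.
Proof. by rewrite /parabola mul0r mulr0. Qed.

Lemma parabola_right (R : realType) (nu L rho : R) : parabola nu L rho L = 0.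
Proof. by rewrite /parabola subrr !mulr0. Qed.

Lemma parabola_le (R : realType) (nu L rho x : R) :
  0 < nu -> 0 < rho -> 0 < x < L -> parabola nu L rho x <= rho / (2 * nu) * L ^+ 2.
Proof.
move=> nu0 r0 /andP[x0 xL]; rewrite /parabola ler_wpM2l ?divr_ge0 ?mulr_ge0 ?ltW//.
by nra.
Qed.

Lemma lap_unitmx (R : realType) (nu h : R) n : 0 < nu -> 0 < h -> lap nu h n \in unitmx.
Proof.
move=> nu0 h0.
pose L := n.+1%:R * h.
apply: (@metzler_unitmx _ _ _ (\col_j parabola nu L 1 ((0 + j.+1)%:R * h))) => [i j|i|i].
- exact: lap_offdiag.
- rewrite mxE parabola_gt0// mulr_gt0//= ltr_pM2r// ltr_nat add0n ltnS.
  exact: ltn_ord.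
- rewrite -oppr_gt0.
  rewrite (_ : - _ =
    (- (lap nu h n *m \col_j parabola nu L 1 ((0 + j.+1)%:R * h))) i 0); last first.
    by rewrite [RHS]mxE.
  rewrite (@lap_parabola _ nu h L 1 0 0 n nu0 h0) mxE add0n mul0r.
  by rewrite parabola_left parabola_right !mulr0 !if_same !addr0.
Qed.

(** * Derivatives relative to a time interval *)

Definition lipschitz_on (R : realType) (T K : R) (g : R -> R) : Prop :=
  forall s t, 0 <= s <= T -> 0 <= t <= T -> `|g s - g t| <= K * `|s - t|.

Lemma has_deriv_on_coord (R : realType) n (T : R) (u : R -> 'cV[R]_n) t l (i : 'I_n) :
  has_deriv_on T u t l -> has_deriv_on (V := R^o) T (fun t => u t i 0) t (l i 0).
Proof.
move=> Du.
rewrite /has_deriv_on; apply: cvg_trans (cvg_comp _ _ Du (@coord_continuous R n 1 i 0 l)).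
by apply: near_eq_cvg; apply: nearW => s; rewrite /= /diff_quot !mxE.
Qed.

(** In the interior the restriction to [0, T] is invisible, so that [has_deriv_on]
is an ordinary derivative and the filter is proper. *)
Lemma within_dnbhs_interior (R : realType) (T t : R) :
  0 < t < T -> within `[0, T] t^' = t^'.
Proof.
move=> tT; have tin : \forall s \near t^', `[0, T]%classic s.
  apply: nbhs_dnbhs; apply: filterS (near_in_itvoo _).
    by move=> s; exact: subset_itv_oo_cc.
  by rewrite in_itv.
apply/seteqP; split => P /=; last exact: cvg_within.
by move=> wP; apply: filterS2 tin wP => s H; exact.
Qed.

Lemma deriv_onE (R : realType) (T t l : R) (g : R -> R) :
  0 < t < T -> has_deriv_on (V := R^o) T g t l -> deriv_on T g t = l.
Proof.
move=> tT; rewrite /has_deriv_on /deriv_on within_dnbhs_interior// => D.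
by apply: cvg_lim.
Qed.

Lemma is_derive_has_deriv_on (R : realType) (T t l : R) (g : R -> R) :
  0 < t < T -> has_deriv_on (V := R^o) T g t l -> is_derive t (1 : R) g l.
Proof.
move=> tT; rewrite /has_deriv_on within_dnbhs_interior// => D.
have D' : h^-1 *: (g (h *: (1 : R) + t) - g t) @[h --> (0 : R)^'] --> l.
  have -> : (fun h => h^-1 *: (g (h *: (1 : R) + t) - g t)) =
      (diff_quot (V := R^o) g t) \o (fun h => h + t).
    by apply/funext => h; rewrite /diff_quot/= addrK [h *: 1]mulr1.
  apply: cvg_comp D.
  move=> P; rewrite /= !near_simpl => /nbhs_ballP[e /= e0 eP].
  apply/nbhs_ballP; exists e => //= h he h0; apply: eP.
    by move: he; rewrite /ball/= opprD addrCA subrr addr0 sub0r.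
  by apply: contra_neq h0 => /(canRL (addrK _)) ->; rewrite subrr.
split; first by apply/cvg_ex; exists l.
by apply: cvg_lim.
Qed.

Lemma continuous_has_deriv_on (R : realType) (T : R) (g dg : R -> R) :
  (forall t, 0 <= t <= T -> has_deriv_on (V := R^o) T g t (dg t)) ->
  {within `[0, T], continuous g}.
Proof.
move=> Dg; apply/subspace_continuousP => t; rewrite /= in_itv/= => tT.
have := Dg t tT; rewrite /has_deriv_on => /cvgrPdist_lt/(_ _ ltr01).
rewrite near_withinE => /nbhs_ballP[d /= d0 dP].
apply/cvgrPdist_lt => e e0; rewrite near_withinE.
set B := `|dg t| + 1.
have B0 : 0 < B by rewrite ltr_wpDl.
apply/nbhs_ballP; exists (Num.min d (e / B)) => /=; first by rewrite lt_min d0 divr_gt0.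
move=> s; rewrite /ball/= lt_min => /andP[sd se] sT.
have [->|st] := eqVneq s t; first by rewrite subrr normr0.
have := dP s sd st sT; rewrite /diff_quot => close.
have st0 : 0 < `|s - t| by rewrite normr_gt0 subr_eq0.
have : `|(s - t)^-1 *: (g s - g t) : R^o| < B.
  have -> : (s - t)^-1 *: (g s - g t) = dg t - (dg t - (s - t)^-1 *: (g s - g t)).
    by rewrite opprB addrCA subrr addr0.
  by apply: le_lt_trans (ler_normB _ _) _; rewrite ltrD2l.
rewrite normrM normfV mulrC ltr_pdivrMr// => H.
rewrite distrC; apply: lt_trans H _.
by rewrite mulrC -ltr_pdivlMr// distrC.
Qed.

Lemma continuous_bounded_on (R : realType) (T : R) (g : R -> R) :
  0 <= T -> {within `[0, T], continuous g} ->
  exists B, forall t, 0 <= t <= T -> `|g t| <= B.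
Proof.
move=> T0 cg.
have cn : {within `[0, T], continuous (fun t => `|g t|)}.
  by move=> x; apply: cvg_norm; exact: cg.
have [c _ cmax] := EVT_max T0 cn.
by exists `|g c| => t tT; apply: cmax; rewrite in_itv.
Qed.

Lemma C1_on_continuous (R : realType) (T : R) (g : R -> R) :
  C1_on T g -> {within `[0, T], continuous g}.
Proof. by move=> [dg [_ Dg]]; exact: continuous_has_deriv_on Dg. Qed.

Lemma C1_on_lipschitz (R : realType) (T : R) (g : R -> R) :
  0 <= T -> C1_on T g -> exists K, lipschitz_on T K g.
Proof.
move=> T0 [dg [cdg Dg]]; have [K KP] := continuous_bounded_on T0 cdg.
exists K; apply: (@lipschitz_of_derive _ g dg).
- exact: continuous_has_deriv_on Dg.
- move=> t /andP[t0 tT]; apply: (@is_derive_has_deriv_on _ T); first by rewrite t0.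
  by apply: Dg; rewrite !ltW.
- by move=> t /andP[t0 tT]; apply: KP; rewrite !ltW.
Qed.

Lemma vcompE (R : realType) n (v : 'cV[R]_n) (i : 'I_n) : vcomp v i.+1 = v i 0.
Proof. by rewrite /vcomp (big_pred1 i)// => j; rewrite eqSS. Qed.

Lemma lipschitz_on_le (R : realType) (T K K' : R) (g : R -> R) :
  K <= K' -> lipschitz_on T K g -> lipschitz_on T K' g.
Proof.
move=> KK' H s t sT tT; apply: le_trans (H s t sT tT) _.
by rewrite ler_wpM2r.
Qed.

Lemma coord_within_continuous (R : realType) n (T : R) (u : R -> 'cV[R]_n) (i : 'I_n) :
  {within `[0, T], continuous u} -> {within `[0, T], continuous (fun t => u t i 0)}.
Proof. by move=> cu x; exact: (cvg_comp _ _ (cu x) (@coord_continuous R n 1 i 0 _)). Qed.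

Lemma rhs_bounded (R : realType) (nu h T : R) (k n : nat)
    (f : R -> R -> R) (a b : R -> R) (u : R -> 'cV[R]_n) (i : 'I_n) :
  0 <= T ->
  {within `[0, T], continuous u} ->
  {within `[0, T], continuous (f ((k + i.+1)%:R * h))} ->
  {within `[0, T], continuous a} ->
  {within `[0, T], continuous b} ->
  exists B, forall t, 0 <= t <= T ->
     `|(lap nu h n *m u t + forcing nu h k n f t (a t) (b t)) i 0| <= B.
Proof.
move=> T0 cu cf ca cb; apply: continuous_bounded_on => //.
have -> : (fun t => (lap nu h n *m u t + forcing nu h k n f t (a t) (b t)) i 0) =
  (fun t => \sum_j lap nu h n i j * u t j 0 +
   (f ((k + i.+1)%:R * h) t + (if i.+1 == 1%N then nu / h ^+ 2 * a t else 0)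
     + (if i.+1 == n then nu / h ^+ 2 * b t else 0))).
  by apply/funext => t; rewrite [LHS]mxE; congr (_ + _); rewrite mxE.
have cc j : {within `[0, T], continuous (fun t => u t j 0)}.
  exact: coord_within_continuous.
move=> x; apply: cvgD.
  apply: cvg_big => //=.
    by move=> [p q]/=; apply: cvgD; [exact: cvg_fst|exact: cvg_snd].
  by move=> j _; apply: cvgMr; exact: cc.
apply: cvgD; first apply: cvgD; first exact: cf.
  by case: ifP => _; [apply: cvgMr; exact: ca|exact: cvg_cst].
by case: ifP => _; [apply: cvgMr; exact: cb|exact: cvg_cst].
Qed.

(** * One time step *)

(** The strict improvement on one subdomain.  The initial error is at most [q],
hence strictly below [theta q], and [theta rho] still covers the cost [rho] of
freezing the forcing, while [theta] times the boundary values of [q] covers the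
errors of the boundary data. *)
Lemma subdomain_step (R : realType) (nu h L T K theta t0 t1 a1 b1 : R) (k n : nat)
    (f : R -> R -> R) (a b : R -> R) (u : R -> 'cV[R]_n) (v : 'cV[R]_n) :
  0 < nu -> 0 < h -> 0 <= K -> 1 < theta -> 0 <= t0 -> t0 <= t1 -> t1 <= T ->
  (forall i, {within `[t0, t1], continuous (fun t => u t i 0)}) ->
  (forall i t, t0 < t < t1 -> is_derive t (1 : R) (fun t => u t i 0)
     ((lap nu h n *m u t + forcing nu h k n f t (a t) (b t)) i 0)) ->
  (forall i : 'I_n, lipschitz_on T K (f ((k + i.+1)%:R * h))) ->
  lipschitz_on T K a ->
  lipschitz_on T K b ->
  let q m := parabola nu L (K * (1 + 2 * (nu / h ^+ 2)) * (t1 - t0)) (m%:R * h) in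
  `|a t1 - a1| <= theta * q k ->
  `|b t1 - b1| <= theta * q (k + n.+1)%N ->
  (forall i : 'I_n, 0 < q (k + i.+1)%N) ->
  (forall i : 'I_n, `|u t0 i 0 - v i 0| <= q (k + i.+1)%N) ->
  forall i : 'I_n, `|u t1 i 0 - etd1_step (lap nu h n) (t1 - t0) v
     (forcing nu h k n f t1 a1 b1) i 0| < theta * q (k + i.+1)%N.
Proof.
move=> nu0 h0 K0 th1 t00 t01 t1T cu Du lf la lb.
set ka := nu / h ^+ 2; set rho := K * _ * _ => q abd bbd q0 init i.
have ka0 : 0 <= ka by rewrite divr_ge0 ?exprn_ge0 ?ltW.
pose y : 'cV[R]_n := theta *: \col_j q (k + j.+1)%N.
have yE j : y j 0 = theta * q (k + j.+1)%N by rewrite !mxE.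
rewrite -yE.
apply: (@etd1_step_error _ _ _ u (fun t => forcing nu h k n f t (a t) (b t)))
  => {i} [||i j||i t tt|i] //.
- exact: lap_unitmx.
- exact: lap_offdiag.
- have Ay : - (lap nu h n *m y) i 0 =
      theta * (rho + (if i.+1 == 1%N then ka * q k else 0)
                   + (if i.+1 == n then ka * q (k + n.+1)%N else 0)).
    rewrite -scalemxAr (_ : - _ = theta * (- (lap nu h n *m \col_j q (k + j.+1)%N)) i 0).
      by rewrite (@lap_parabola _ nu h L rho 0 k n nu0 h0) mxE.
    by rewrite [in RHS]mxE mxE mulrN.
  have /andP[tt0 tt1] := tt.
  have tT : 0 <= t <= T by rewrite (le_trans t00 (ltW tt0)) (le_trans (ltW tt1) t1T).
  have t1T' : 0 <= t1 <= T by rewrite (le_trans t00 t01).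
  have dt : `|t - t1| <= t1 - t0 by rewrite distrC ger0_norm ?subr_ge0 ?lerD2l ?lerN2 ltW.
  have D0 : 0 <= t1 - t0 by rewrite subr_ge0.
  set D := t1 - t0 in dt D0 rho q abd bbd q0 init y yE Ay *.
  have lip g : lipschitz_on T K g -> `|g t - g t1| <= K * D.
    by move=> lg; apply: le_trans (lg _ _ tT t1T') _; rewrite ler_wpM2l.
  have bdr (c : bool) g g1 (w : R) : lipschitz_on T K g -> `|g t1 - g1| <= theta * w ->
      `|(if c then ka * g t else 0) - (if c then ka * g1 else 0)|
      <= ka * (K * D) + theta * (if c then ka * w else 0).
    move=> lg gw; case: c => /=; last by rewrite subrr normr0 mulr0 addr0 mulr_ge0// mulr_ge0.
    rewrite -mulrBr normrM (ger0_norm ka0) [theta * _]mulrCA -mulrDr ler_wpM2l//.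
    rewrite (_ : g t - g1 = (g t - g t1) + (g t1 - g1)); last by ring.
    exact: le_trans (ler_normD _ _) (lerD (lip _ lg) gw).
  rewrite Ay !mxE -/ka.
  have Ea := bdr (i.+1 == 1%N) _ _ _ la abd.
  have Eb := bdr (i.+1 == n) _ _ _ lb bbd.
  have Ef := lip _ (lf i).
  have rth : rho <= theta * rho.
    have rho0 : 0 <= rho.
      by apply: mulr_ge0 => //; apply: mulr_ge0 => //; apply: addr_ge0 => //; apply: mulr_ge0.
    by rewrite ler_peMl// ltW.
  (* One share of rho for the source, one for each boundary value. *)
  have rE : rho = K * D + ka * (K * D) + ka * (K * D) by rewrite /rho; ring.
  move: Ea Eb Ef rth; rewrite rE.
  move: (if i.+1 == 1%N then ka * a t else 0) (if i.+1 == 1%N then ka * a1 else 0) => A A1.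
  move: (if i.+1 == n then ka * b t else 0) (if i.+1 == n then ka * b1 else 0) => B B1.
  move: (if i.+1 == 1%N then _ else _) (if i.+1 == n then _ else _) => A0 B0.
  move: (f _ t) (f _ t1) => x x1 Ea Eb Ef rth.
  rewrite (_ : _ - _ = (x - x1) + (A - A1) + (B - B1)); last by ring.
  apply: le_trans (ler_normD _ _) _.
  apply: le_trans (lerD (ler_normD _ _) (lexx _)) _.
  lra.
- by rewrite yE; apply: le_lt_trans (init i) _; rewrite ltr_pMl.
Qed.

(** The grid is described through [h] alone, as the error constant may depend on
[h] but receives neither the number of nodes nor the interface indices. *)
Definition data_modulus (R : realType) (L T h : R) (g1 g2 : R -> R)
    (f : R -> R -> R) (psi1 psi2 : R -> R) (K : R) : Prop :=
  [/\ 0 < K,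
      forall j : nat, 0 < j%:R * h < L -> lipschitz_on T K (f (j%:R * h)),
      lipschitz_on T K psi1, lipschitz_on T K psi2 &
      forall t, 0 < t < T -> `|g1 t| <= K /\ `|g2 t| <= K].

Lemma deriv_on_vcomp (R : realType) n (T t : R) (u : R -> 'cV[R]_n) l (i : 'I_n) :
  0 < t < T -> has_deriv_on T u t l ->
  deriv_on T (fun t => vcomp (u t) i.+1) t = l i 0.
Proof.
move=> tT /has_deriv_on_coord D; rewrite -(deriv_onE tT (D i)).
by congr (deriv_on T _ t); apply/funext => s; rewrite vcompE.
Qed.

Lemma grid_interior (R : realType) (L h : R) (N j : nat) :
  0 < L -> h = L / N.+1%:R -> (0 < j%:R * h < L) = (0 < j < N.+1)%N.
Proof.
move=> L0 ->; have N0 : 0 < N.+1%:R :> R by rewrite ltr0n.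
rewrite pmulr_lgt0 ?divr_gt0// ltr0n; congr (_ && _).
by rewrite mulrA ltr_pdivrMr// [L * _]mulrC ltr_pM2r// ltr_nat.
Qed.

Lemma subdomain_indices (N Na Nb : nat) :
  (1 < Na)%N -> (Na < Nb)%N -> (Nb < N)%N ->
  [/\ (Na.-1 < Nb - 1)%N, ((Nb - Na).-1 < N - Na)%N,
      (Na + (Nb - Na) = 0 + (Nb - 1).+1)%N /\ (Na + (N - Na).+1 = N.+1)%N,
      forall i : 'I_(Nb - 1), (0 < 0 + i.+1 < N.+1)%N &
      forall i : 'I_(N - Na), (0 < Na + i.+1 < N.+1)%N].
Proof.
move=> Na1 NaNb NbN; split=> [|||[i iP]|[i iP]] /=; [lia|lia|split; lia|lia|lia].
Qed.

(** The interface derivatives are bounded because they are components of the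
right-hand side of the semi-discrete system, which is continuous up to [t = 0]. *)
Lemma data_modulus_exists (R : realType) (nu L T h : R) (N Na Nb : nat)
    (f : R -> R -> R) (psi1 psi2 u0 : R -> R)
    (u1 : R -> 'cV[R]_(Nb - 1)) (u2 : R -> 'cV[R]_(N - Na)) :
  0 < L -> 0 < T -> h = L / N.+1%:R ->
  (1 < Na)%N -> (Na < Nb)%N -> (Nb < N)%N ->
  smooth_data nu L T f psi1 psi2 u0 ->
  semidiscrete_solution nu h T f psi1 psi2 u0 u1 u2 ->
  exists K, data_modulus L T h (deriv_on T (fun t => vcomp (u1 t) Na))
            (deriv_on T (fun t => vcomp (u2 t) (Nb - Na))) f psi1 psi2 K.
Proof.
move=> L0 T0 hE Na1 NaNb NbN [_ fC p1C p2C] [cu1 cu2 Du _ _].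
have T0' := ltW T0.
have h0 : 0 < h by rewrite hE divr_gt0.
have [K1 lK1] := C1_on_lipschitz T0' p1C.
have [K2 lK2] := C1_on_lipschitz T0' p2C.
have /choice[Kf lKf] (j : nat) : exists K, 0 < j%:R * h < L -> lipschitz_on T K (f (j%:R * h)).
  have [/fC/(C1_on_lipschitz T0')[K lK]|] := boolP (0 < j%:R * h < L); first by exists K.
  by exists 0.
have [i1P i2P [nE1 nE2] r1 r2] := subdomain_indices Na1 NaNb NbN.
(* Components are numbered from 1 in vcomp but indexed from 0 in matrices. *)
pose i1 := Ordinal i1P; pose i2 := Ordinal i2P.
have e1 : Na = i1.+1 by rewrite /= prednK// ltnW.
have e2 : (Nb - Na)%N = i2.+1 by rewrite /= prednK// subn_gt0.
have cv2 : {within `[0, T], continuous (fun t => vcomp (u2 t) (Nb - Na))}.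
  rewrite e2 (_ : (fun t => _) = fun t => u2 t i2 0).
    exact: coord_within_continuous.
  by apply/funext => t; rewrite vcompE.
have cv1 : {within `[0, T], continuous (fun t => vcomp (u1 t) Na)}.
  rewrite e1 (_ : (fun t => _) = fun t => u1 t i1 0).
    exact: coord_within_continuous.
  by apply/funext => t; rewrite vcompE.
have cf (j : nat) : (0 < j < N.+1)%N -> {within `[0, T], continuous (f (j%:R * h))}.
  by rewrite -(grid_interior j L0 hE) => /fC/C1_on_continuous.
have [G1 G1P] : exists B, forall t, 0 < t < T ->
    `|deriv_on T (fun t => vcomp (u1 t) Na) t| <= B.
  have cf1 : {within `[0, T], continuous (f ((0 + i1.+1)%:R * h))}.
    by apply: cf; exact: r1.
  have [B BP] := rhs_bounded nu T0' cu1 cf1 (C1_on_continuous p1C) cv2.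
  exists B => t tT; have /andP[t0 tT'] := tT.
  have /Du[D _] : 0 < t <= T by rewrite t0 ltW.
  rewrite e1 (deriv_on_vcomp i1 tT D).
  by apply: BP; rewrite !ltW.
have [G2 G2P] : exists B, forall t, 0 < t < T ->
    `|deriv_on T (fun t => vcomp (u2 t) (Nb - Na)) t| <= B.
  have cf2 : {within `[0, T], continuous (f ((Na + i2.+1)%:R * h))}.
    by apply: cf; exact: r2.
  have [B BP] := rhs_bounded nu T0' cu2 cf2 cv1 (C1_on_continuous p2C).
  exists B => t tT; have /andP[t0 tT'] := tT.
  have /Du[_ D] : 0 < t <= T by rewrite t0 ltW.
  rewrite e2 (deriv_on_vcomp i2 tT D).
  by apply: BP; rewrite !ltW.
(* Sums of absolute values serve as common upper bounds. *)
pose S := \sum_(j < N.+1) `|Kf j|.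
have S0 : 0 <= S by apply: sumr_ge0.
exists (1 + `|K1| + `|K2| + `|G1| + `|G2| + S).
have := (normr_ge0 K1, normr_ge0 K2, normr_ge0 G1, normr_ge0 G2).
have := (ler_norm K1, ler_norm K2, ler_norm G1, ler_norm G2).
move=> [[[k1 k2] k3] k4] [[[k1' k2'] k3'] k4'].
split.
- lra.
- move=> j jL; apply: lipschitz_on_le (lKf j jL).
  have /andP[_ jN] : (0 < j < N.+1)%N by rewrite -(grid_interior j L0 hE).
  have : Kf j <= S.
    rewrite /S (bigD1 (Ordinal jN))//=; apply: le_trans (ler_norm _) _.
    by rewrite lerDl sumr_ge0.
  lra.
- by apply: lipschitz_on_le lK1; lra.
- by apply: lipschitz_on_le lK2; lra.
- by move=> t tT; split; [apply: le_trans (G1P t tT) _|apply: le_trans (G2P t tT) _]; lra.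
Qed.

(** Both subdomains are treated at once, as each takes its boundary error at the
new time from the other. *)
Lemma coupled_step (R : realType) (nu L T h K t0 t1 : R) (N Na Nb : nat)
    (f : R -> R -> R) (psi1 psi2 u0 : R -> R)
    (u1 : R -> 'cV[R]_(Nb - 1)) (u2 : R -> 'cV[R]_(N - Na))
    (v1 v1' : 'cV[R]_(Nb - 1)) (v2 v2' : 'cV[R]_(N - Na)) :
  0 < nu -> 0 < L -> h = L / N.+1%:R ->
  (1 < Na)%N -> (Na < Nb)%N -> (Nb < N)%N ->
  semidiscrete_solution nu h T f psi1 psi2 u0 u1 u2 ->
  data_modulus L T h (deriv_on T (fun t => vcomp (u1 t) Na))
    (deriv_on T (fun t => vcomp (u2 t) (Nb - Na))) f psi1 psi2 K ->
  0 <= t0 -> t0 < t1 -> t1 <= T ->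
  v1' = etd1_step (lap nu h (Nb - 1)) (t1 - t0) v1
    (forcing nu h 0 (Nb - 1) f t1 (psi1 t1) (vcomp v2' (Nb - Na))) ->
  v2' = etd1_step (lap nu h (N - Na)) (t1 - t0) v2
    (forcing nu h Na (N - Na) f t1 (vcomp v1' Na) (psi2 t1)) ->
  let q m := parabola nu L (K * (1 + 2 * (nu / h ^+ 2)) * (t1 - t0)) (m%:R * h) in
  (forall i : 'I_(Nb - 1), `|u1 t0 i 0 - v1 i 0| <= q (0 + i.+1)%N) ->
  (forall i : 'I_(N - Na), `|u2 t0 i 0 - v2 i 0| <= q (Na + i.+1)%N) ->
  (forall i : 'I_(Nb - 1), `|u1 t1 i 0 - v1' i 0| <= q (0 + i.+1)%N) /\
  (forall i : 'I_(N - Na), `|u2 t1 i 0 - v2' i 0| <= q (Na + i.+1)%N).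
Proof.
move=> nu0 L0 hE Na1 NaNb NbN [cu1 cu2 Du _ _] [K0 lf lp1 lp2 gK] t00 t01 t1T E1 E2 q
  init1 init2.
have h0 : 0 < h by rewrite hE divr_gt0.
have [i1P i2P [nE1 nE2] r1 r2] := subdomain_indices Na1 NaNb NbN.
pose i1 := Ordinal i1P; pose i2 := Ordinal i2P.
have e1 : Na = i1.+1 by rewrite /= prednK// ltnW.
have e2 : (Nb - Na)%N = i2.+1 by rewrite /= prednK// subn_gt0.
have Du1 i t : 0 < t < T -> is_derive t (1 : R) (fun t => u1 t i 0)
    ((lap nu h (Nb - 1) *m u1 t
     + forcing nu h 0 (Nb - 1) f t (psi1 t) (vcomp (u2 t) (Nb - Na))) i 0).
  move=> tT; apply: (is_derive_has_deriv_on tT); apply: has_deriv_on_coord.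
  by have /andP[tt0 tt1] := tT; apply: (Du t _).1; rewrite tt0 ltW.
have Du2 i t : 0 < t < T -> is_derive t (1 : R) (fun t => u2 t i 0)
    ((lap nu h (N - Na) *m u2 t
     + forcing nu h Na (N - Na) f t (vcomp (u1 t) Na) (psi2 t)) i 0).
  move=> tT; apply: (is_derive_has_deriv_on tT); apply: has_deriv_on_coord.
  by have /andP[tt0 tt1] := tT; apply: (Du t _).2; rewrite tt0 ltW.
(* The interface values are Lipschitz because K bounds their derivatives. *)
have lv1 : lipschitz_on T K (fun t => vcomp (u1 t) Na).
  rewrite e1 (_ : (fun t => _) = fun t => u1 t i1 0); last first.
    by apply/funext => t; rewrite vcompE.
  apply: (lipschitz_of_derive _ (Du1 i1)); first exact: coord_within_continuous.
  move=> t tT; have /andP[tt0 tt1] := tT.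
  have /Du[D _] : 0 < t <= T by rewrite tt0 ltW.
  by rewrite -(deriv_on_vcomp i1 tT D) -e1; case: (gK t tT).
have lv2 : lipschitz_on T K (fun t => vcomp (u2 t) (Nb - Na)).
  rewrite e2 (_ : (fun t => _) = fun t => u2 t i2 0); last first.
    by apply/funext => t; rewrite vcompE.
  apply: (lipschitz_of_derive _ (Du2 i2)); first exact: coord_within_continuous.
  move=> t tT; have /andP[tt0 tt1] := tT.
  have /Du[_ D] : 0 < t <= T by rewrite tt0 ltW.
  by rewrite -(deriv_on_vcomp i2 tT D) -e2; case: (gK t tT).
have ka0 : 0 < 1 + 2 * (nu / h ^+ 2).
  by apply: addr_gt0 => //; apply: mulr_gt0 => //; apply: divr_gt0 => //; exact: exprn_gt0.
have q0 (j : nat) : (0 < j < N.+1)%N -> 0 < q j.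
  move=> jN; apply: parabola_gt0 => //; last by rewrite (grid_interior j L0 hE).
  by rewrite mulr_gt0 ?subr_gt0// mulr_gt0.
have q10 (i : 'I_(Nb - 1)) : 0 < q (0 + i.+1)%N by apply: q0; exact: r1.
have q20 (i : 'I_(N - Na)) : 0 < q (Na + i.+1)%N by apply: q0; exact: r2.
have ql : q 0%N = 0 by rewrite /q mul0r parabola_left.
have qr : q N.+1 = 0.
  by rewrite /q [X in parabola _ _ _ X](_ : _ = L) ?parabola_right// hE mulrC divfK// pnatr_eq0.
have tsub t : t0 < t < t1 -> 0 < t < T.
  by move=> /andP[a b]; rewrite (le_lt_trans t00 a) (lt_le_trans b t1T).
have csub (g : R -> R) : {within `[0, T], continuous g} -> {within `[t0, t1], continuous g}.
  apply: continuous_subspaceW => t /=; rewrite !in_itv/= => /andP[a b].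
  by rewrite (le_trans t00 a) (le_trans b t1T).
pose e (i : 'I_(Nb - 1) + 'I_(N - Na)) : R := match i with
  | inl i => u1 t1 i 0 - v1' i 0 | inr i => u2 t1 i 0 - v2' i 0 end.
pose z (i : 'I_(Nb - 1) + 'I_(N - Na)) : R := match i with
  | inl i => q (0 + i.+1)%N | inr i => q (Na + i.+1)%N end.
suff H : forall i, `|e i| <= z i by split=> i; [exact: (H (inl i))|exact: (H (inr i))].
(* The interface bounds below are instances of the assumed bound bd on the
   other subdomain, as q is one function of the global node number. *)
apply: self_improving_bound => [[i|i]|theta th1 bd]; [exact: q10|exact: q20|].
have bd1 : `|vcomp (u1 t1) Na - vcomp v1' Na| <= theta * q Na.
  by have := bd (inl i1); rewrite /e /z add0n -!vcompE -e1.
have bd2 : `|vcomp (u2 t1) (Nb - Na) - vcomp v2' (Nb - Na)| <= theta * q (0 + (Nb - 1).+1)%N.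
  have := bd (inr i2); rewrite /e /z -!vcompE -e2.
  by rewrite nE1.
have bdl : `|psi1 t1 - psi1 t1| <= theta * q 0%N by rewrite ql subrr normr0 mulr0.
have bdr : `|psi2 t1 - psi2 t1| <= theta * q (Na + (N - Na).+1)%N.
  by rewrite nE2 qr subrr normr0 mulr0.
have c1 i : {within `[t0, t1], continuous (fun t => u1 t i 0)}.
  by apply: csub; exact: coord_within_continuous.
have c2 i : {within `[t0, t1], continuous (fun t => u2 t i 0)}.
  by apply: csub; exact: coord_within_continuous.
have lf1 (i : 'I_(Nb - 1)) : lipschitz_on T K (f ((0 + i.+1)%:R * h)).
  by apply: lf; rewrite (grid_interior _ L0 hE); exact: r1.
have lf2 (i : 'I_(N - Na)) : lipschitz_on T K (f ((Na + i.+1)%:R * h)).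
  by apply: lf; rewrite (grid_interior _ L0 hE); exact: r2.
case=> i; rewrite /e /z.
- rewrite E1.
  exact: (@subdomain_step R nu h L T K theta t0 t1 (psi1 t1) (vcomp v2' (Nb - Na))
    0 (Nb - 1) f psi1 (fun t => vcomp (u2 t) (Nb - Na)) u1 v1 nu0 h0 (ltW K0) th1 t00
    (ltW t01) t1T c1 (fun i t tt => Du1 i t (tsub t tt)) lf1 lp1 lv2 bdl bd2 q10 init1 i).
- rewrite E2.
  exact: (@subdomain_step R nu h L T K theta t0 t1 (vcomp v1' Na) (psi2 t1)
    Na (N - Na) f (fun t => vcomp (u1 t) Na) psi2 u2 v2 nu0 h0 (ltW K0) th1 t00
    (ltW t01) t1T c2 (fun i t tt => Du2 i t (tsub t tt)) lf2 lv1 lp2 bd1 bdr q20 init2 i).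
Qed.

(** * The global error *)

Lemma norm_infT_le (R : realType) n M (v : nat -> 'cV[R]_n) (B : R) :
  0 <= B -> (forall m (i : 'I_n), (0 < m <= M)%N -> `|v m i 0| <= B) ->
  norm_infT M v <= B.
Proof.
move=> B0 vB; rewrite /norm_infT big_seq_cond bigmax_le// => m.
rewrite andbT mem_index_iota ltnS => mM.
by apply: bigmax_le => // i _; exact: vB.
Qed.

(** The barrier does not grow with [m], so that induction over the steps yields
the same bound [q <= rho L^2 / (2 nu)] at all times; the two subdomains together
give [rho L^2 / nu]. *)
Lemma etd1_error_bound (R : realType) (nu L T h K : R) (N Na Nb M : nat)
    (f : R -> R -> R) (psi1 psi2 u0 : R -> R)
    (u1 : R -> 'cV[R]_(Nb - 1)) (u2 : R -> 'cV[R]_(N - Na))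
    (v1 : nat -> 'cV[R]_(Nb - 1)) (v2 : nat -> 'cV[R]_(N - Na)) :
  0 < nu -> 0 < L -> 0 < T -> h = L / N.+1%:R ->
  (1 < Na)%N -> (Na < Nb)%N -> (Nb < N)%N -> (0 < M)%N ->
  semidiscrete_solution nu h T f psi1 psi2 u0 u1 u2 ->
  data_modulus L T h (deriv_on T (fun t => vcomp (u1 t) Na))
    (deriv_on T (fun t => vcomp (u2 t) (Nb - Na))) f psi1 psi2 K ->
  etd1_solution nu h (T / M%:R) M f psi1 psi2 (u1 0) (u2 0) v1 v2 ->
  etd1_error T M u1 u2 v1 v2
    <= K * (1 + 2 * (nu / h ^+ 2)) / nu * L ^+ 2 * (T / M%:R).
Proof.
move=> nu0 L0 T0 hE Na1 NaNb NbN M0 semi mod [v10 v20 steps].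
have [_ _ _ r1 r2] := subdomain_indices Na1 NaNb NbN.
have K0 : 0 < K by case: mod.
have h0 : 0 < h by rewrite hE divr_gt0.
set dt := T / M%:R.
have M0' : 0 < M%:R :> R by rewrite ltr0n.
have dt0 : 0 < dt by rewrite divr_gt0.
have ka0 : 0 < 1 + 2 * (nu / h ^+ 2).
  apply: addr_gt0 => //; apply: mulr_gt0 => //; apply: divr_gt0 => //; exact: exprn_gt0.
set rho := K * (1 + 2 * (nu / h ^+ 2)) * dt.
have rho0 : 0 < rho by rewrite /rho mulr_gt0// mulr_gt0.
pose q m := parabola nu L rho (m%:R * h).
have qle j : (0 < j < N.+1)%N -> 0 < q j <= rho / (2 * nu) * L ^+ 2.
  rewrite -(grid_interior j L0 hE) => jL.
  by rewrite parabola_gt0//= parabola_le.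
have bd m : (m <= M)%N ->
    (forall i, `|u1 (m%:R * dt) i 0 - v1 m i 0| <= q (0 + i.+1)%N) /\
    (forall i, `|u2 (m%:R * dt) i 0 - v2 m i 0| <= q (Na + i.+1)%N).
  elim: m => [_|m IH mM].
    rewrite mul0r v10 v20; split=> i; rewrite subrr normr0 ltW//.
      by have /andP[] := qle _ (r1 i).
    by have /andP[] := qle _ (r2 i).
  have [b1 b2] := IH (ltnW mM); have [s1 s2] := steps m mM.
  have dtE : m.+1%:R * dt - m%:R * dt = dt by rewrite -natr1 mulrDl mul1r addrC addrA addNr add0r.
  have t01 : m%:R * dt < m.+1%:R * dt by rewrite ltr_pM2r// ltr_nat.
  have t1T : m.+1%:R * dt <= T.
    by rewrite /dt mulrCA ler_piMr ?(ltW T0)// ler_pdivrMr// mul1r ler_nat.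
  have t00 : 0 <= m%:R * dt by rewrite mulr_ge0// ltW.
  have := @coupled_step R nu L T h K (m%:R * dt) (m.+1%:R * dt) N Na Nb f psi1 psi2 u0 u1 u2
    (v1 m) (v1 m.+1) (v2 m) (v2 m.+1) nu0 L0 hE Na1 NaNb NbN semi mod t00 t01 t1T.
  by rewrite dtE; exact.
have B0 : 0 <= rho / (2 * nu) * L ^+ 2.
  by apply: mulr_ge0; [apply: divr_ge0; [|apply: mulr_ge0]|apply: exprn_ge0] => //; exact: ltW.
rewrite (_ : _ * dt = rho / (2 * nu) * L ^+ 2 + rho / (2 * nu) * L ^+ 2); last first.
  by rewrite /rho; field; rewrite !gt_eqF.
apply: lerD; apply: norm_infT_le => // m i /andP[_ mM]; rewrite !mxE;
  have [b1 b2] := bd m mM.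
  apply: le_trans (b1 i) _; by have /andP[] := qle _ (r1 i).
by apply: le_trans (b2 i) _; have /andP[] := qle _ (r2 i).
Qed.

Lemma etd1_error_ge0 (R : realType) (T : R) (M n1 n2 : nat)
    (u1 : R -> 'cV[R]_n1) (u2 : R -> 'cV[R]_n2)
    (v1 : nat -> 'cV[R]_n1) (v2 : nat -> 'cV[R]_n2) :
  0 <= etd1_error T M u1 u2 v1 v2.
Proof. by rewrite addr_ge0// /norm_infT bigmax_ge_id. Qed.

Theorem theorem4p5 (R : realType) (nu L : R) (hnu : 0 < nu) (hL : 0 < L) :
  (* C : T -> size of overlap -> h -> u_1'(N_alpha, .) ->
         u_2'(N_{beta,alpha}, .) -> f -> psi_1 -> psi_2 -> R *)
  exists C : R -> R -> R -> (R -> R) -> (R -> R) -> (R -> R -> R) ->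
             (R -> R) -> (R -> R) -> R,
  forall (T h alpha beta : R) (N Na Nb : nat)
    (f : R -> R -> R) (psi1 psi2 u0 : R -> R)
    (u1 : R -> 'cV[R]_(Nb - 1)) (u2 : R -> 'cV[R]_(N - Na)),
  0 < T ->
  h = L / N.+1%:R ->
  0 < alpha -> alpha < beta -> beta < 1 ->
  (1 < Na)%N -> (Na < Nb)%N -> (Nb < N)%N ->
  alpha * L = Na%:R * h ->
  beta * L = Nb%:R * h ->
  smooth_data nu L T f psi1 psi2 u0 ->
  semidiscrete_solution nu h T f psi1 psi2 u0 u1 u2 ->
  (forall (w1 : nat -> nat -> 'cV[R]_(Nb - 1))
          (w2 : nat -> nat -> 'cV[R]_(N - Na)),
     (forall M : nat, (0 < M)%N ->
        etd1_solution nu h (T / M%:R) M f psi1 psi2 (u1 0) (u2 0)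
          (w1 M) (w2 M)) ->
     etd1_error T M u1 u2 (w1 M) (w2 M) @[M --> \oo] --> (0 : R)) /\
  (forall (M : nat)
          (v1 : nat -> 'cV[R]_(Nb - 1)) (v2 : nat -> 'cV[R]_(N - Na)),
     (0 < M)%N ->
     etd1_solution nu h (T / M%:R) M f psi1 psi2 (u1 0) (u2 0) v1 v2 ->
     etd1_error T M u1 u2 v1 v2
       <= C T ((beta - alpha) * L) h
            (deriv_on T (fun t => vcomp (u1 t) Na))
            (deriv_on T (fun t => vcomp (u2 t) (Nb - Na)))
            f psi1 psi2 * (T / M%:R)).
Proof.
pose C T h g1 g2 f psi1 psi2 : R :=
  xget 0 (data_modulus L T h g1 g2 f psi1 psi2) * (1 + 2 * (nu / h ^+ 2)) / nu * L ^+ 2.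
exists (fun T _ h g1 g2 f psi1 psi2 => C T h g1 g2 f psi1 psi2).
move=> T h alpha beta N Na Nb f psi1 psi2 u0 u1 u2 T0 hE _ _ _ Na1 NaNb NbN _ _ smooth semi.
have mod := xgetPex 0 (data_modulus_exists hL T0 hE Na1 NaNb NbN smooth semi).
set D := C _ _ _ _ _ _ _.
have bound M v1 v2 : (0 < M)%N ->
    etd1_solution nu h (T / M%:R) M f psi1 psi2 (u1 0) (u2 0) v1 v2 ->
    etd1_error T M u1 u2 v1 v2 <= D * (T / M%:R).
  by move=> M0; exact: (etd1_error_bound hnu hL T0 hE Na1 NaNb NbN M0 semi mod).
split=> // w1 w2 sol.
have lim0 : D * (T / M%:R) @[M --> \oo] --> (0 : R).
  rewrite (_ : (0 : R) = D * (T * 0)); last by rewrite !mulr0.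
  (* The harmonic sequence is 1 / (M + 1), hence the shift of the index. *)
  apply: cvgMr; apply: cvgMr; rewrite -(cvg_shiftS _).
  exact: cvg_harmonic.
apply: (@squeeze_cvgr _ _ _ _ (fun=> 0) (fun M : nat => D * (T / M%:R))) => //; last exact: cvg_cst.
near=> M; rewrite etd1_error_ge0/=.
have M0 : (0 < M)%N by near: M; exists 1%N.
by apply: bound => //; exact: sol.
Unshelve. all: by end_near. Qed.
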